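(* Let $k$ be a nonnegative integer, let $\mathbf u=u_1+u_2+\cdots+u_k$, and for $\mathfrak a=(\pi,\phi)\in\mathsf A_n^k$ let $$\mathrm{col}(\mathfrak a)=\prod_{i\in\mathsf{Fix}(\pi)}u_{\phi(i)}.$$ Let $\mathcal C_{\mathbf u}(z)$ be the continued fraction $\mathcal C(z)$ with $\mathbf u$ substituted for $u$. Then $$\mathcal C_{\mathbf u}(z)=\sum_{n\ge0}\sum_{\mathfrak a=(\sigma,\phi)\in\mathsf A_n^k}\mathrm{col}(\mathfrak a)\,a^{\mathsf{ile}(\sigma)} b^{\mathsf{nile}(\sigma)} c^{\mathsf{ie}(\sigma)-\mathsf{ile}(\sigma)} d^{\mathsf{nie}(\sigma)-\mathsf{nile}(\sigma)} f^{\mathsf{ilae}(\sigma)} g^{\mathsf{nilae}(\sigma)} h^{\mathsf{iae}(\sigma)-\mathsf{ilae}(\sigma)} \ell^{\mathsf{niae}(\sigma)-\mathsf{nilae}(\sigma)}\, p^{\mathsf{exc}(\sigma)-\mathsf{le}(\sigma)} r^{\mathsf{aexc}(\sigma)-\mathsf{lae}(\sigma)} s^{\mathsf{le}(\sigma)} t^{\mathsf{lae}(\sigma)} w^{\mathsf{iefp}(\sigma)} z^n .$$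
   Context: $[n]=\{1,\dots,n\}$, $\mathcal S_n$ is the set of permutations of $[n]$, and $\mathsf{Fix}(\pi)$ is the set of fixed points of $\pi$. A $k$-arrangement of $[n]$ is a pair $\mathfrak a=(\pi,\phi)$ with $\pi\in\mathcal S_n$ and $\phi:\mathsf{Fix}(\pi)\to[k]$ an arbitrary map (for $k=0$: a derangement, i.e. a fixed-point-free permutation); the set of these is $\mathsf A_n^k$, and $\mathsf A_0^k$ consists of the empty word only. An empty sum is $0$, an empty product is $1$, and $0^0=1$. For $n\ge1$, $[n]_{x,y}:=\sum_{i=0}^{n-1}x^{n-1-i}y^{i}$, and $[0]_{x,y}:=0$. For parameters $a,b,c,d,f,g,h,\ell,p,r,s,t,u,w$, $\mathcal C(z)$ is the formal power series in $z$ defined by the continued fraction $$\mathcal C(z)=\cfrac{1}{1-\alpha_0z-\cfrac{\beta_1z^2}{1-\alpha_1z-\cfrac{\beta_2z^2}{\ddots}}},\qquad \alpha_n=u\,w^n+s\,[n]_{a,b}+t\,[n]_{f,g}\ (n\ge 0),\quad \beta_n=p\,r\,[n]_{c,d}\,[n]_{h,\ell}\ (n\ge 1).$$ For $\sigma\in\mathcal S_n$ (indices $i$, and ordered pairs $(i,j)$, range over $[n]$): - $\mathsf{exc}(\sigma)=\#\{i: i<\sigma(i)\}$, $\mathsf{aexc}(\sigma)=\#\{i: i>\sigma(i)\}$; - $\mathsf{le}(\sigma)=\#\{i:\sigma^{-1}(i)<i<\sigma(i)\}$, $\mathsf{lae}(\sigma)=\#\{i:\sigma^{-1}(i)>i>\sigma(i)\}$;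 - $\mathsf{ie}(\sigma)=\#\{(i,j): i<j<\sigma(j)<\sigma(i)\}$, $\mathsf{ile}(\sigma)=\#\{(i,j): i<j<\sigma(j)<\sigma(i),\ \sigma^{-1}(j)<j\}$; - $\mathsf{nie}(\sigma)=\#\{(i,j): i<j<\sigma(i)<\sigma(j)\}$, $\mathsf{nile}(\sigma)=\#\{(i,j): i<j<\sigma(i)<\sigma(j),\ \sigma^{-1}(j)<j\}$; - $\mathsf{iae}(\sigma)=\#\{(i,j): j>i>\sigma(i)>\sigma(j)\}$, $\mathsf{ilae}(\sigma)=\#\{(i,j): j>i>\sigma(i)>\sigma(j),\ \sigma^{-1}(i)>i\}$; - $\mathsf{niae}(\sigma)=\#\{(i,j): j>i>\sigma(j)>\sigma(i)\}$, $\mathsf{nilae}(\sigma)=\#\{(i,j): j>i>\sigma(j)>\sigma(i),\ \sigma^{-1}(i)>i\}$; - $\mathsf{iefp}(\sigma)=\#\{(i,j): i<j=\sigma(j)<\sigma(i)\}$. *)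

(* Defs.v *)
From mathcomp Require Import all_boot all_fingroup all_algebra.

Set Implicit Arguments.
Unset Strict Implicit.
Unset Printing Implicit Defensive.

Import GRing.Theory.
Local Open Scope ring_scope.

(* A formal power series is its coefficient sequence. The ring operations are
   named explicitly because [nat -> R] also carries the pointwise structure. *)
Definition fps (R : comNzRingType) := nat -> R.

Definition fps_monom (R : comNzRingType) (x : R) (m : nat) : fps R :=
  fun n => if n == m then x else 0.

Definition fps_sub (R : comNzRingType) (F G : fps R) : fps R :=
  fun n => F n - G n.

Definition fps_mul (R : comNzRingType) (F G : fps R) : fps R :=
  fun n => \sum_(i < n.+1) F (n - i)%N * G i.

(* The first n coefficients of 1 / F, for F with constant term 1. *)
Fixpoint fps_inv_prefix (R : comNzRingType) (F : fps R) (n : nat) : seq R :=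
  if n is m.+1 then
    let s := fps_inv_prefix F m in
    rcons s ((m == 0)%:R - \sum_(i < m) F (m - i)%N * s`_i)
  else [::].

Definition fps_inv (R : comNzRingType) (F : fps R) : fps R :=
  fun n => (fps_inv_prefix F n.+1)`_n.

Lemma size_fps_inv_prefix (R : comNzRingType) (F : fps R) n :
  size (fps_inv_prefix F n) = n.
Proof. by elim: n => //= n IHn; rewrite size_rcons IHn. Qed.

Lemma nth_fps_inv_prefix (R : comNzRingType) (F : fps R) n i :
  (i < n)%N -> (fps_inv_prefix F n)`_i = fps_inv F i.
Proof.
elim: n => // n IHn; rewrite ltnS leq_eqVlt => /predU1P[-> //|lt_in].
by rewrite /= nth_rcons size_fps_inv_prefix lt_in IHn.
Qed.

Lemma fps_invE (R : comNzRingType) (F : fps R) n :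
  fps_inv F n = (n == 0)%:R - \sum_(i < n) F (n - i)%N * fps_inv F i.
Proof.
rewrite /fps_inv /= nth_rcons size_fps_inv_prefix ltnn eqxx; congr (_ - _).
by apply: eq_bigr => i _; rewrite nth_fps_inv_prefix.
Qed.

Lemma fps_mulV (R : comNzRingType) (F : fps R) :
  F 0 = 1 -> fps_mul F (fps_inv F) =1 fps_monom 1 0.
Proof.
move=> F0 n; rewrite /fps_mul big_ord_recr /= subnn F0 mul1r fps_invE addrC.
by rewrite subrK /fps_monom; case: eqP.
Qed.

(* The denominator 1 - x z - y z^2 G of one level of the continued fraction. *)
Definition jden (R : comNzRingType) (x y : R) (G : fps R) : fps R :=
  fps_sub (fps_sub (fps_monom 1 0) (fps_monom x 1)) (fps_mul (fps_monom y 2) G).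

Lemma jden0 (R : comNzRingType) (x y : R) (G : fps R) : jden x y G 0 = 1.
Proof.
by rewrite /jden /fps_sub /fps_mul /fps_monom big_ord1 /= mul0r !subr0.
Qed.

(* The tail from level j of the continued fraction, truncated to N levels. *)
Fixpoint jconv (R : comNzRingType) (alpha beta : nat -> R) (N j : nat)
    : fps R :=
  if N is N'.+1 then
    fps_inv (jden (alpha j) (beta j.+1) (jconv alpha beta N' j.+1))
  else fun=> 0.

Lemma jconvS (R : comNzRingType) (alpha beta : nat -> R) N j :
  fps_mul (jden (alpha j) (beta j.+1) (jconv alpha beta N j.+1))
    (jconv alpha beta N.+1 j) =1 fps_monom 1 0.
Proof. exact/fps_mulV/jden0. Qed.

(* F is the value of the infinite continued fraction: the convergents tend
   to F in the z-adic topology, i.e. each coefficient is eventually that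
   of F. *)
Definition is_jfraction (R : comNzRingType) (alpha beta : nat -> R)
    (F : fps R) : Prop :=
  forall n, exists N0, forall N, (N0 <= N)%N -> jconv alpha beta N 0 n = F n.

Lemma is_jfraction_unique (R : comNzRingType) (alpha beta : nat -> R)
    (F G : fps R) :
  is_jfraction alpha beta F -> is_jfraction alpha beta G -> F =1 G.
Proof.
move=> cvF cvG n; have [N1 EF] := cvF n; have [N2 EG] := cvG n.
by rewrite -(EF _ (leq_maxl N1 N2)) EG ?leq_maxr.
Qed.

Definition bracket (R : comNzRingType) (x y : R) (n : nat) : R :=
  \sum_(i < n) x ^+ (n - 1 - i) * y ^+ i.

Definition alphaC (R : comNzRingType) (a b f g s t u w : R) (n : nat) : R :=
  u * w ^+ n + s * bracket a b n + t * bracket f g n.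

Definition betaC (R : comNzRingType) (c d h l p r : R) (n : nat) : R :=
  p * r * bracket c d n * bracket h l n.

(* [n] is modelled by 'I_n = {0, .., n-1}: every statistic below depends only
   on the relative order of positions and values. *)
Section Statistics.
Variables (n : nat) (sigma : 'S_n).
Local Open Scope nat_scope.

Local Notation sigmaV := (sigma^-1)%g.

Definition st_exc := #|[set i : 'I_n | i < sigma i]|.
Definition st_aexc := #|[set i : 'I_n | i > sigma i]|.
Definition st_le := #|[set i : 'I_n | sigmaV i < i < sigma i]|.
Definition st_lae := #|[set i : 'I_n | sigma i < i < sigmaV i]|.

Definition st_ie :=
  #|[set ij : 'I_n * 'I_n | let: (i, j) := ij in
     [&& i < j, j < sigma j & sigma j < sigma i]]|.
Definition st_ile :=
  #|[set ij : 'I_n * 'I_n | let: (i, j) := ij in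
     [&& i < j, j < sigma j, sigma j < sigma i & sigmaV j < j]]|.
Definition st_nie :=
  #|[set ij : 'I_n * 'I_n | let: (i, j) := ij in
     [&& i < j, j < sigma i & sigma i < sigma j]]|.
Definition st_nile :=
  #|[set ij : 'I_n * 'I_n | let: (i, j) := ij in
     [&& i < j, j < sigma i, sigma i < sigma j & sigmaV j < j]]|.
Definition st_iae :=
  #|[set ij : 'I_n * 'I_n | let: (i, j) := ij in
     [&& j > i, i > sigma i & sigma i > sigma j]]|.
Definition st_ilae :=
  #|[set ij : 'I_n * 'I_n | let: (i, j) := ij in
     [&& j > i, i > sigma i, sigma i > sigma j & sigmaV i > i]]|.
Definition st_niae :=
  #|[set ij : 'I_n * 'I_n | let: (i, j) := ij in
     [&& j > i, i > sigma j & sigma j > sigma i]]|.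
Definition st_nilae :=
  #|[set ij : 'I_n * 'I_n | let: (i, j) := ij in
     [&& j > i, i > sigma j, sigma j > sigma i & sigmaV i > i]]|.
Definition st_iefp :=
  #|[set ij : 'I_n * 'I_n | let: (i, j) := ij in
     [&& i < j, j == sigma j & sigma j < sigma i]]|.

Definition fixpt := {i : 'I_n | sigma i == i}.

End Statistics.

(* k-arrangements (sigma, phi) with phi : Fix(sigma) -> [k]. A notation rather
   than a definition, so that the finType structure is inferred. *)
Notation arrangement n k := {sigma : 'S_n & {ffun fixpt sigma -> 'I_k}}.

Definition colw (R : comNzRingType) (n k : nat) (u : 'I_k -> R)
    (x : arrangement n k) : R :=
  \prod_(i : fixpt (tag x)) u (tagged x i).

(* Main.v *)
(* Foata-Zeilberger style, but the Laguerre histories stay implicit. Scan the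
   points from left to right and remove each one as soon as it closes its arcs.
   After k open excedances and k open anti-excedances, what remains is a
   permutation whose first k positions, and hence first k values, all belong to
   open arcs. Nestings of anti-excedances are charged to the point that closes
   one of them, so they are decided during the scan; those of excedances are
   charged to the opening point. To decouple the latter from the rest of the
   permutation, position j < k gets arbitrary parameters x_j, y_j: the sum over
   these permutations is then prod_(j < k) [j+1]_(x_j, y_j) times the weight of
   the Motzkin paths from height k to 0, with horizontal weight alpha_k, rises
   p [k+1]_(c,d) and falls r [k]_(h,l), whose generating function at k = 0 is
   the continued fraction. *)
Require Import Defs.
From mathcomp Require Import all_boot all_fingroup all_algebra.
From mathcomp Require Import zify ring.

Set Implicit Arguments.
Unset Strict Implicit.
Unset Printing Implicit Defensive.

Import GRing.Theory.
Local Open Scope ring_scope.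

(** * Motzkin paths and continued fractions *)

Section MotzkinPaths.
Variables (R : comNzRingType) (alpha down up : nat -> R).

Fixpoint motzkin (m k : nat) : R :=
  if m is m'.+1 then
    alpha k * motzkin m' k + up k * motzkin m' k.+1
      + (if k is k'.+1 then down k * motzkin m' k' else 0)
  else (k == 0)%:R.

Let trunc (M : nat) (F : fps R) : {poly R} := \poly_(i < M) F i.

(** Truncation carries the continued fraction equation over to polynomials, where [ring] applies;
    coefficients below [M] involve no others. *)
Lemma coef_jden_mul M (x y : R) (F G : fps R) n : (n < M)%N ->
  ((1 - x%:P * 'X - y%:P * 'X^2 * trunc M G) * trunc M F)`_n
    = fps_mul (jden x y G) F n.
Proof.
move=> ltnM.
have E m : (m < M)%N -> (1 - x%:P * 'X - y%:P * 'X^2 * trunc M G)`_m = jden x y G m.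
  move=> ltmM; rewrite /jden /fps_sub /fps_monom /fps_mul !coefB coefCM coefX coef1 -mulrA coefCM coefXnM coef_poly.
  congr (_ - _).
    by congr (_ - _); case: eqP; rewrite ?mulr1 ?mulr0 ?mulr1n ?mulr0n //.
  rewrite big_ord_recr /=.
  case: ltnP => [lt2|le2].
    rewrite mulr0 big1 ?add0r => [|i _]; case: ifP => [/eqP h|_]; rewrite ?mul0r //; first lia.
    exfalso; lia.
  rewrite (_ : (m - 2 < M)%N = true); last lia.
  have lt : (m - 2 < m)%N by lia.
  rewrite (bigD1 (Ordinal lt)) //= big1 ?addr0 => [|i /negP ne]; last first.
    case: ifP => [/eqP h|_]; rewrite ?mul0r //.
    by case: ne; apply/eqP/val_inj => /=; lia.
  rewrite (_ : (m - (m - 2) == 2)%N); last by apply/eqP; lia.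
  by rewrite (_ : (m - m == 2)%N = false) ?mul0r ?addr0; last lia.
rewrite coefMr /fps_mul; apply: eq_bigr => i _; rewrite E; last lia.
by congr (_ * _); rewrite coef_poly; case: ltnP => //; have := ltn_ord i; lia.
Qed.

(* First-passage decomposition: a path from k to 0 is a path staying above k - 1,
   then a fall, then a path from k - 1 to 0. *)
Fixpoint descent (C : nat -> {poly R}) (k : nat) : {poly R} :=
  if k is k'.+1 then C k * ((down k)%:P * 'X) * descent C k' else C 0.

Lemma jfraction_motzkin (beta : nat -> R) (F : fps R) :
  (forall k, beta k.+1 = up k * down k.+1) ->
  (forall n, F n = motzkin n 0) ->
  is_jfraction alpha beta F.
Proof.
move=> Ebeta EF n; exists n.+1 => N ltnN; rewrite EF.
(* All tails come from one convergent of depth [N]: level [k] keeps [N - k] levels, so consecutive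
   levels satisfy the exact equation [jC]. *)
pose C k := trunc N (jconv alpha beta (N - k) k).
have jC k m : (k < N)%N -> (m < N)%N ->
    ((1 - (alpha k)%:P * 'X - (beta k.+1)%:P * 'X^2 * C k.+1) * C k)`_m = (m == 0)%:R.
  move=> ltkN ltmN; rewrite /C (_ : N - k = (N - k.+1).+1)%N; last lia.
  by rewrite coef_jden_mul // jconvS /fps_monom; case: eqP.
(* The bound keeps a path of length [m] from height [k] within the levels of this convergent. *)
suff D m k : (m + k < N)%N -> (descent C k)`_m = motzkin m k.
  by rewrite -D ?addn0 //= /C coef_poly ltnN subn0.
have rec m' k' : (k' < N)%N -> (m' < N)%N ->
    (descent C k' - (k' == 0)%:R - (alpha k')%:P * 'X * descent C k'
     - (up k')%:P * 'X * descent C k'.+1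
     - (if k' is k''.+1 then (down k')%:P * 'X * descent C k'' else 0))`_m' = 0.
  move=> ltk ltm.
  (* Since [descent C k'] is [C k' * y], the defect in the Motzkin recursion is [y] times the defect
     in the continued fraction equation, which vanishes below degree [N]. *)
  pose y := (k' == 0)%:R + (if k' is k''.+1 then (down k')%:P * 'X * descent C k'' else 0).
  have Ed : descent C k' = C k' * y.
    rewrite /y; case: (k') => [|k''] /=; first by rewrite addr0 mulr1.
    by rewrite add0r !mulrA.
  have -> : descent C k' - (k' == 0)%:R - (alpha k')%:P * 'X * descent C k'
     - (up k')%:P * 'X * descent C k'.+1
     - (if k' is k''.+1 then (down k')%:P * 'X * descent C k'' else 0)
   = y * ((1 - (alpha k')%:P * 'X - (beta k'.+1)%:P * 'X^2 * C k'.+1) * C k' - 1).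
    rewrite [descent C k'.+1]/= !Ed Ebeta polyCM /y.
    move: (match _ with 0%N => _ | S _ => _ end) (_%:R) => e1 e2; ring.
  rewrite coefM big1 // => i _; rewrite coefB jC //; last lia.
  by rewrite coef1 subrr mulr0.
elim: m k => [|m IH] k ltN.
  case: k ltN => [|k] ltN /=.
    have := jC 0 0 ltN ltN; rewrite !(coef0M, coefB, coef1, coefX, coefXn) /=.
    by rewrite !(mulr0, mul0r, subr0, mul1r).
  by rewrite -!mulrA mulrCA coefCM mulrCA coefXM !mulr0.
have [ltk ltm] : (k < N)%N /\ (m.+1 < N)%N by lia.
have /eqP := rec _ _ ltk ltm; rewrite !coefB.
rewrite -!mulrA !coefCM !coefXM [(m.+1 == 0)%N]/= [m.+1.-1]/= !IH; try lia.
have -> : ((k == 0)%:R : {poly R})`_m.+1 = 0 by rewrite -polyC_natr coefC.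
rewrite subr0 -!addrA -!opprD subr_eq0 => /eqP ->; rewrite !addrA /=; congr (_ + _).
case: k ltN ltk => [|k'] ltN _; first exact: coef0.
by rewrite -mulrA coefCM coefXM /= IH //; lia.
Qed.

End MotzkinPaths.

(** * Removing a point from a permutation *)

(** [lower i s] deletes position [i] together with its value and relabels; for [i = q] this inverts
    [lift_perm q v]. *)
Lemma reindex_lift_perm (R : nmodType) n (q v : 'I_n.+1) (P : pred 'S_n.+1)
    (F : 'S_n.+1 -> R) :
  \sum_(s | P s && (s q == v)) F s
    = \sum_(s : 'S_n | P (lift_perm q v s)) F (lift_perm q v s).
Proof.
rewrite (reindex (lift_perm q v)).
  by apply: eq_bigl => s; rewrite lift_perm_id eqxx andbT.
pose lower i (s : 'S_n.+1) j := odflt j (unlift (s i) (s (lift i j))).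
have lowerK i (s : 'S_n.+1) j : lift (s i) (lower i s j) = s (lift i j).
  rewrite /lower; have := neq_lift i j.
  by rewrite -(can_eq (permK s)) => /unlift_some[] ? ? ->.
have inj_lower : injective (lower q _).
  move=> s; apply: can_inj (lower (s q) s^-1%g) _ => j.
  by rewrite {1}/lower lowerK !permK liftK.
exists (fun s => perm (inj_lower s)) => [s _ | s].
  by apply/permP=> j; rewrite permE /lower lift_perm_lift lift_perm_id liftK.
case/andP=> _ /eqP sq; apply/permP=> j.
case: (unliftP q j) => [i|] ->; rewrite ?lift_perm_id //.
by rewrite lift_perm_lift -sq permE lowerK.
Qed.

(** * Local weights of permutations with open arcs *)

Section Weights.
Variables (R : comNzRingType) (a b c d f g h l p r s t u w : R).
Implicit Types (n k : nat) (x y : nat -> R).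

(* x marks nestings and y crossings, of the arc i -> si with the arc j -> sj. *)
Definition upper_weight (x y : R) (i si j sj : nat) : R :=
  (if [&& j < i & si < sj]%N then x else 1)
  * (if [&& j < i, i < sj & sj < si]%N then y else 1).

Definition lower_weight (x y : R) (i si j sj : nat) : R :=
  (if [&& i < j & sj < si]%N then x else 1)
  * (if [&& i < j, si < sj & sj < i]%N then y else 1).

Definition fixed_weight (i j sj : nat) : R :=
  if [&& j < i & i < sj]%N then w else 1.

(* Positions i < k have parameters x i, y i instead of a, b or c, d, and no factor
   s or p. *)
Definition local_weight n k x y (sigma : 'S_n) (i : 'I_n) : R :=
  if (i < sigma i)%N then
    if (i < k)%N then \prod_(j < n) upper_weight (x i) (y i) i (sigma i) j (sigma j)
    else if ((sigma^-1)%g i < i)%N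
    then s * \prod_(j < n) upper_weight a b i (sigma i) j (sigma j)
    else p * \prod_(j < n) upper_weight c d i (sigma i) j (sigma j)
  else if (sigma i < i)%N then
    if (i < (sigma^-1)%g i)%N
    then t * \prod_(j < n) lower_weight f g i (sigma i) j (sigma j)
    else r * \prod_(j < n) lower_weight h l i (sigma i) j (sigma j)
  else u * \prod_(j < n) fixed_weight i j (sigma j).

(** Two bounds, because one point is treated in stages: [opens k k] holds before point [k] is
    scanned, [opens k k.+1] says that moreover no open excedance closes at [k], and [opens k.-1 k]
    is what remains after removing one that does. *)
Definition opens n A B (sigma : 'S_n) :=
  [forall i : 'I_n, (i < A)%N ==> (B <= sigma i)%N].

Lemma opensP n A B (sigma : 'S_n) :
  reflect (forall i : 'I_n, (i < A)%N -> (B <= sigma i)%N) (opens A B sigma).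
Proof. by apply: (iffP forallP) => H i; apply/implyP/H. Qed.

(** * Weight of the point being scanned *)

Lemma prod_if_lt n m (x : R) : (m <= n)%N ->
  \prod_(j < n) (if (j < m)%N then x else 1) = x ^+ m.
Proof.
move=> le_mn; rewrite -big_mkcond /= (big_ord_narrow le_mn) /=.
by rewrite prodr_const card_ord.
Qed.

Lemma prod_if_between n m1 m2 (x : R) : (m1 < m2 <= n)%N ->
  \prod_(j < n) (if (m1 < j < m2)%N then x else 1) = x ^+ (m2 - 1 - m1).
Proof.
move=> /andP[lt12 le2].
pose F j := if (m1 < j < m2)%N then x else 1.
rewrite -(big_mkord xpredT F) (@big_cat_nat _ _ _ m1.+1) /=; try lia.
rewrite big_nat big1 ?mul1r => [|i hi]; last by rewrite /F ifF //; lia.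
rewrite (@big_cat_nat _ _ _ m2) /=; try lia.
rewrite [X in _ * X]big_nat [X in _ * X]big1 ?mulr1 => [|i hi]; last by rewrite /F ifF //; lia.
rewrite big_nat (eq_bigr (fun=> x)) => [|i hi]; last by rewrite /F ifT //; lia.
by rewrite -big_nat prodr_const_nat; congr (_ ^+ _); lia.
Qed.

Lemma perm_val_inj n (sigma : 'S_n) (i j : 'I_n) :
  (sigma i = sigma j :> nat) <-> (i = j :> nat).
Proof. by split=> [/val_inj/perm_inj->|/val_inj->]. Qed.

(** The values below [k] belong to the open anti-excedances. Those below [sigma i] nest the arc that
    closes at [k], those between [sigma i] and [k] cross it; reindexing by [sigma] counts values
    instead of positions. *)
Lemma lower_weight_at n k (sigma : 'S_n) (i : 'I_n) (x y : R) :
  opens k k sigma -> i = k :> nat -> (sigma i < k)%N ->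
  \prod_(j < n) lower_weight x y i (sigma i) j (sigma j)
    = x ^+ (sigma i) * y ^+ (k - 1 - sigma i).
Proof.
move=> /opensP op ik lt.
rewrite big_split /=; congr (_ * _).
  rewrite -(prod_if_lt x (ltnW (ltn_ord (sigma i)))) [RHS](reindex_inj (@perm_inj _ sigma)).
  apply: eq_bigr => j _; congr (if _ then _ else _).
  have := op j; have := @perm_val_inj _ sigma j i; lia.
have ltn : (sigma i < k <= n)%N by rewrite lt -ik ltnW.
rewrite -(prod_if_between y ltn) [RHS](reindex_inj (@perm_inj _ sigma)).
apply: eq_bigr => j _; congr (if _ then _ else _).
have := op j; have := @perm_val_inj _ sigma j i; lia.
Qed.

Lemma fixed_weight_at n k (sigma : 'S_n) (i : 'I_n) :
  opens k k.+1 sigma -> i = k :> nat ->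
  \prod_(j < n) fixed_weight i j (sigma j) = w ^+ k.
Proof.
move=> /opensP op ik.
rewrite -(@prod_if_lt n k); last by rewrite -ik ltnW.
by apply: eq_bigr => j _; rewrite /fixed_weight; congr (if _ then _ else _); have := op j; lia.
Qed.

(** The excedance from [q] has the least open value, so it is nested in the arcs from all [q]
    positions on its left. *)
Lemma upper_weight_at n k (sigma : 'S_n) (q : 'I_n) (x y : R) :
  opens k k sigma -> (q < k)%N -> sigma q = k :> nat ->
  \prod_(j < n) upper_weight x y q (sigma q) j (sigma j) = x ^+ q.
Proof.
move=> /opensP op lt sq; rewrite big_split /= [X in _ * X]big1 ?mulr1 => [|j _]; last first.
  by rewrite ifF //; have := op j; lia.
rewrite -(@prod_if_lt n q); last by rewrite ltnW.
apply: eq_bigr => j _; congr (if _ then _ else _).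
have := op j; have := @perm_val_inj _ sigma j q; lia.
Qed.

Lemma bigM_ordD1 n (q : 'I_n.+1) (F : 'I_n.+1 -> R) :
  \prod_(j < n.+1) F j = F q * \prod_(j < n) F (lift q j).
Proof. exact: bigD1_ord. Qed.

(** * Removal of an excedance that closes *)

Section LiftOpen.
Variables (n k : nat) (q kk : 'I_n.+1) (sigma : 'S_n) (i : 'I_n) (X Y : R).
Hypotheses (ltqk : (q < k)%N) (kkE : kk = k :> nat) (op : opens k.-1 k sigma).
Local Notation tau := (lift_perm q kk sigma).

(** The arc from [q] to [k] crosses every open excedance that starts between [q] and [k], as these
    end beyond [k]; hence the factor [Y]. Position [k.-1] is the former position [k], where the arc
    has ended. *)
Lemma upper_weight_lift_open : (i < sigma i)%N -> (i = k.-1 :> nat -> k <= sigma i)%N ->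
  \prod_(j < n.+1) upper_weight X Y (lift q i) (tau (lift q i)) j (tau j)
  = \prod_(j < n) upper_weight X Y i (sigma i) j (sigma j)
    * (if (q <= i < k.-1)%N then Y else 1).
Proof using ltqk kkE op.
move=> up iA; have /opensP opj := op; have opi := opj i.
rewrite (bigM_ordD1 q) mulrC lift_perm_id; congr (_ * _).
  apply: eq_bigr => j _; rewrite !lift_perm_lift /upper_weight /= /bump kkE.
  have := opj j => opj'; congr (_ * _); congr (if _ then _ else _); lia.
rewrite lift_perm_lift /upper_weight /= /bump kkE ifF ?mul1r; last lia.
congr (if _ then _ else _); lia.
Qed.

Lemma lower_weight_lift_open : (k <= i)%N -> (sigma i < i)%N ->
  \prod_(j < n.+1) lower_weight X Y (lift q i) (tau (lift q i)) j (tau j)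
  = \prod_(j < n) lower_weight X Y i (sigma i) j (sigma j).
Proof using ltqk kkE op.
move=> leki lo; have /opensP opj := op; have opi := opj i.
rewrite (bigM_ordD1 q) lift_perm_id.
rewrite lift_perm_lift /lower_weight /= /bump kkE !ifF ?mul1r; try lia.
apply: eq_bigr => j _; rewrite !lift_perm_lift /= /bump ?kkE.
have := opj j => opj'; congr (_ * _); congr (if _ then _ else _); lia.
Qed.

Lemma fixed_weight_lift_open : (k <= i)%N ->
  \prod_(j < n.+1) fixed_weight (lift q i) j (tau j)
  = \prod_(j < n) fixed_weight i j (sigma j).
Proof using ltqk kkE op.
move=> leki; have /opensP opj := op; have opi := opj i.
rewrite (bigM_ordD1 q) lift_perm_id.
rewrite /fixed_weight /= /bump kkE !ifF ?mul1r; try lia.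
apply: eq_bigr => j _; rewrite !lift_perm_lift /= /bump ?kkE.
have := opj j => opj'; congr (if _ then _ else _); lia.
Qed.

End LiftOpen.

(* Removing the excedance (q, k) makes position k the last open one, whence its
   parameters a, b, unless position k carries an anti-excedance. *)
Lemma local_weight_lift_open n k x y x' y' (q kk : 'I_n.+1) (sigma : 'S_n) (i : 'I_n) :
  (q < k)%N -> kk = k :> nat -> opens k.-1 k sigma ->
  (forall i : nat, (i < k)%N -> x' i = if (i == k.-1)%N then a else x (bump q i)) ->
  (forall i : nat, (i < k)%N -> y' i = if (i == k.-1)%N then b else y (bump q i)) ->
  (i = k.-1 :> nat -> k <= sigma i)%N ->
  local_weight k x y (lift_perm q kk sigma) (lift q i) =
   (if i == k.-1 :> nat then s else 1) * local_weight k x' y' sigma i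
   * (if (q <= i < k.-1)%N then y i.+1 else 1).
Proof.
move=> ltqk kkE op x'E y'E iA.
have /opensP opj := op; have opi := opj i.
have sV : (lift_perm q kk sigma)^-1%g (lift q i) = lift_perm kk q sigma^-1%g (lift q i).
  by rewrite lift_permV.
rewrite /local_weight sV.
have Ls : lift_perm q kk sigma (lift q i) = lift kk (sigma i) by rewrite lift_perm_lift.
have e1 : (lift q i < lift_perm q kk sigma (lift q i))%N = (i < sigma i)%N.
  rewrite Ls /= /bump kkE; lia.
have e2 : (lift_perm q kk sigma (lift q i) < lift q i)%N = (sigma i < i)%N.
  rewrite Ls /= /bump kkE; lia.
rewrite e1 e2.
have Vge : (k <= i)%N -> lift_perm kk q sigma^-1%g (lift q i) = lift q (sigma^-1%g i).
  move=> leki; rewrite (_ : lift q i = lift kk i) ?lift_perm_lift //.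
  by apply: val_inj; rewrite /= /bump kkE; lia.
have bumpi : lift q i = bump q i :> nat by [].
have c1 : (lift q i < k)%N = (i < k.-1)%N by rewrite bumpi /bump; lia.
rewrite c1; have [up|le] := ltnP i (sigma i).
  rewrite !(upper_weight_lift_open _ _ ltqk kkE op) //.
  have [ltik|leki] := ltnP i k.
    rewrite x'E // y'E //; have [iE|ne] := eqVneq (i : nat) k.-1.
      (* Before the removal this is position [k], whose preimage is [q < k]: hence the factor
         [s]. *)
      have -> : lift q i = kk by apply: val_inj; rewrite /= /bump kkE; lia.
      by rewrite lift_perm_id iE ltnn andbF kkE ltqk /= !mulr1.
    have -> : (i < k.-1)%N by lia.
    rewrite mul1r bumpi andbT; congr (_ * _); case: ifP => // le.
    by rewrite /bump le.
  have -> : (i < k.-1)%N = false by lia.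
  have -> : (i == k.-1 :> nat) = false by lia.
  rewrite andbF /= !mulr1 mul1r Vge //.
  rewrite (_ : (lift q (sigma^-1%g i) < bump q i)%N = (sigma^-1%g i < i)%N) //.
  by rewrite /= /bump; lia.
have leki : (k <= i)%N by lia.
have -> : (i == k.-1 :> nat) = false by lia.
have -> : (i < k.-1)%N = false by lia.
rewrite andbF /= !mulr1 mul1r Vge // (fixed_weight_lift_open ltqk kkE op) //.
have [lo|_] := ltnP (sigma i) i => //.
rewrite !(lower_weight_lift_open _ _ ltqk kkE op) //.
by congr (if _ then _ else _); rewrite /= /bump; lia.
Qed.

(** * Removal of a fixed point or of an anti-excedance that closes *)

Section LiftClose.
Variables (n k : nat) (kk v : 'I_n.+1) (sigma : 'S_n) (i : 'I_n) (X Y : R).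
Hypotheses (levk : (v <= k)%N) (kkE : kk = k :> nat) (op : opens k k sigma).
Local Notation tau := (lift_perm kk v sigma).

Lemma upper_weight_lift_close : (i < sigma i)%N ->
  \prod_(j < n.+1) upper_weight X Y (lift kk i) (tau (lift kk i)) j (tau j)
  = \prod_(j < n) upper_weight X Y i (sigma i) j (sigma j).
Proof using levk kkE op.
move=> up; have /opensP opj := op; have opi := opj i.
rewrite (bigM_ordD1 kk) lift_perm_id.
rewrite lift_perm_lift /upper_weight /= /bump kkE !ifF ?mul1r; try lia.
apply: eq_bigr => j _; rewrite !lift_perm_lift /= /bump ?kkE.
have := opj j => opj'; congr (_ * _); congr (if _ then _ else _); lia.
Qed.

Lemma lower_weight_lift_close : (sigma i < i)%N ->
  \prod_(j < n.+1) lower_weight X Y (lift kk i) (tau (lift kk i)) j (tau j)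
  = \prod_(j < n) lower_weight X Y i (sigma i) j (sigma j).
Proof using levk kkE op.
move=> lo; have /opensP opj := op; have opi := opj i.
rewrite (bigM_ordD1 kk) lift_perm_id.
rewrite lift_perm_lift /lower_weight /= /bump kkE !ifF ?mul1r; try lia.
apply: eq_bigr => j _; rewrite !lift_perm_lift /= /bump ?kkE.
have := opj j => opj'; congr (_ * _); congr (if _ then _ else _); lia.
Qed.

Lemma fixed_weight_lift_close : i = sigma i :> nat ->
  \prod_(j < n.+1) fixed_weight (lift kk i) j (tau j)
  = \prod_(j < n) fixed_weight i j (sigma j).
Proof using levk kkE op.
move=> fi; have /opensP opj := op; have opi := opj i.
rewrite (bigM_ordD1 kk) lift_perm_id.
rewrite /fixed_weight /= /bump kkE !ifF ?mul1r; try lia.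
apply: eq_bigr => j _; rewrite !lift_perm_lift /= /bump ?kkE.
have := opj j => opj'; congr (if _ then _ else _); lia.
Qed.

End LiftClose.

(** Excedances and fixed points count only arcs that start before them and end beyond them;
    anti-excedances count only larger positions, and those left lie beyond [k]. The arc from [k] to
    [v <= k] is counted by none. *)
Lemma local_weight_lift_close n k x y (kk v : 'I_n.+1) (sigma : 'S_n) (i : 'I_n) :
  (v <= k)%N -> kk = k :> nat -> opens k k sigma ->
  local_weight k x y (lift_perm kk v sigma) (lift kk i)
  = local_weight k x y sigma i.
Proof.
move=> levk kkE op; have /opensP opj := op; have opi := opj i.
have sV : (lift_perm kk v sigma)^-1%g (lift kk i) = lift_perm v kk sigma^-1%g (lift kk i).
  by rewrite lift_permV.
rewrite /local_weight sV.
have Ls : lift_perm kk v sigma (lift kk i) = lift v (sigma i) by rewrite lift_perm_lift.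
have e1 : (lift kk i < lift_perm kk v sigma (lift kk i))%N = (i < sigma i)%N.
  rewrite Ls /= /bump kkE; lia.
have e2 : (lift_perm kk v sigma (lift kk i) < lift kk i)%N = (sigma i < i)%N.
  rewrite Ls /= /bump kkE; lia.
have c1 : (lift kk i < k)%N = (i < k)%N by rewrite /= /bump kkE; lia.
rewrite e1 e2 c1.
have Vge : (k <= i)%N -> lift_perm v kk sigma^-1%g (lift kk i) = lift kk (sigma^-1%g i).
  move=> leki; rewrite (_ : lift kk i = lift v i) ?lift_perm_lift //.
  by apply: val_inj; rewrite /= /bump kkE; lia.
have [up|le] := ltnP i (sigma i).
  rewrite !(upper_weight_lift_close _ _ levk kkE op) //.
  have [ltik|leki] := ltnP i k.
    by rewrite /= /bump kkE leqNgt ltik.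
  by rewrite Vge //; congr (if _ then _ else _); rewrite /= /bump; lia.
have leki : (k <= i)%N by lia.
have [lo|ge] := ltnP (sigma i) i.
  rewrite !(lower_weight_lift_close _ _ levk kkE op) // Vge //.
  by congr (if _ then _ else _); rewrite /= /bump; lia.
by rewrite (fixed_weight_lift_close levk kkE op) //; lia.
Qed.

(** * Sums over permutations with open arcs *)

Lemma bracketS (x y : R) n : bracket x y n.+1 = x ^+ n + y * bracket x y n.
Proof.
rewrite /bracket big_ord_recl /= subn1 subn0 mulr1; congr (_ + _).
rewrite mulr_sumr; apply: eq_bigr => i _; rewrite exprS mulrCA; congr (_ * (_ ^+ _ * _)).
by rewrite /bump /=; lia.
Qed.

Lemma bracket_rev (x y : R) n : \sum_(i < n) x ^+ i * y ^+ (n - 1 - i) = bracket x y n.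
Proof.
rewrite [LHS](reindex_inj rev_ord_inj) /=; apply: eq_bigr => i _.
by have lt := ltn_ord i; congr (_ ^+ _ * _ ^+ _); lia.
Qed.

(* q is the open excedance with the least value: the one that closes first. *)
Lemma prod_bracket_bump k x y :
  \sum_(q < k.+1) x q ^+ q * (\prod_(i < k) (if (q <= i)%N then y i.+1 else 1))
     * \prod_(j < k) bracket (x (bump q j)) (y (bump q j)) j.+1
  = \prod_(j < k.+1) bracket (x j) (y j) j.+1.
Proof.
elim: k => [|k IH].
  by rewrite !big_ord1 !big_ord0 /bracket big_ord1 !expr0 !mulr1.
(* The first term of [bracketS] is the summand where the last position closes first; the second is
   the factor that the last position gives to each other [q]. *)
rewrite big_ord_recr [RHS]big_ord_recr /= -IH bracketS mulrDr addrC.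
congr (_ + _).
  rewrite big1 => [|i _]; last by rewrite leqNgt ltn_ord.
  rewrite mulr1 mulrC IH; congr (_ * _).
  by apply: eq_bigr => j _; rewrite /bump leqNgt ltn_ord.
rewrite mulr_suml; apply: eq_bigr => q _.
rewrite !big_ord_recr /= /bump -ltnS ltn_ord /= !add1n.
ring.
Qed.

Definition open_sum n k x y : R :=
  \sum_(sigma : 'S_n | opens k k sigma) \prod_(i < n) local_weight k x y sigma i.

Lemma opens_lift_close n A (AA v : 'I_n.+1) (sigma : 'S_n) :
  AA = A :> nat -> (v <= A)%N ->
  opens A A.+1 (lift_perm AA v sigma) = opens A A sigma.
Proof.
move=> AE le; apply/opensP/opensP => op i lti.
  by have := op (lift AA i); rewrite lift_perm_lift /= /bump AE; lia.
case: (unliftP AA i) lti => [j|] -> /=; rewrite ?AE ?ltnn // lift_perm_lift /= /bump => lti.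
have := op j; lia.
Qed.

Lemma opens_lift_open n A (q kk : 'I_n.+1) (sigma : 'S_n) :
  kk = A.+1 :> nat -> (q < A.+1)%N ->
  opens A.+1 A.+1 (lift_perm q kk sigma) = opens A A.+1 sigma.
Proof.
move=> kE lt; apply/opensP/opensP => op i lti.
  by have := op (lift q i); rewrite lift_perm_lift /= /bump kE; lia.
case: (unliftP q i) lti => [j|] -> /=; rewrite ?lift_perm_id ?kE // lift_perm_lift /= /bump => lti.
have := op j; lia.
Qed.

Lemma opens_split n A (AA : 'I_n) (sigma : 'S_n) :
  AA = A :> nat -> opens A A.+1 sigma && (A < sigma AA)%N = opens A.+1 A.+1 sigma.
Proof.
move=> AE; apply/andP/opensP => [[/opensP op lt] i lti|op].
  have [e|ne] := eqVneq i AA; first by rewrite e.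
  by apply: op; have : i <> AA :> nat by [move/val_inj/eqP; apply/negP]; lia.
split; last by apply: op; rewrite AE.
by apply/opensP => i lti; apply: op; lia.
Qed.

Lemma local_weight_openS n A x y (sigma : 'S_n) (i : 'I_n) :
  i != A :> nat -> local_weight A.+1 x y sigma i = local_weight A x y sigma i.
Proof.
by move=> ne; rewrite /local_weight (_ : (i < A.+1) = (i < A))%N //; lia.
Qed.

(** Removing point [A] leaves the same sum whatever its value [v <= A], hence a product. [W] is
    abstract because [v] is weighted differently according to whether an excedance has just
    closed. *)
Lemma open_sum_close n A x y (AA : 'I_n.+1) (W : nat -> R) : AA = A :> nat ->
  \sum_(sigma : 'S_n.+1 | opens A A.+1 sigma && (sigma AA <= A)%N)
     W (sigma AA) * \prod_(i < n) local_weight A x y sigma (lift AA i)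
  = (\sum_(v < A.+1) W v) * open_sum n A x y.
Proof.
move=> AE.
rewrite (partition_big (fun sigma : 'S_n.+1 => sigma AA) (fun v => v <= A)%N) /=; last first.
  by move=> sigma /andP[].
have leA : (A.+1 <= n.+1)%N by rewrite -AE.
rewrite (big_ord_widen _ _ leA) mulr_suml; apply: eq_bigr => v lev.
rewrite (eq_bigl (fun sigma : 'S_n.+1 => opens A A.+1 sigma && (sigma AA == v))); last first.
  by move=> sigma; case: eqP => [->|]; rewrite ?andbF // (lev : (v <= A)%N) !andbT.
rewrite reindex_lift_perm mulr_sumr.
apply: eq_big => [sigma|sigma op]; first exact: opens_lift_close.
rewrite lift_perm_id; congr (_ * _); apply: eq_bigr => i _.
by apply: local_weight_lift_close => //; rewrite -(opens_lift_close _ AE lev).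
Qed.

Lemma prod_if_eq n (i0 : 'I_n) (x : R) :
  \prod_(i < n) (if i == i0 :> nat then x else 1) = x.
Proof. by rewrite -big_mkcond /= (big_pred1 i0). Qed.

(** * Points at which an excedance closes *)

Section CloseExcedance.
Variables (n A : nat) (x y : nat -> R) (q kk : 'I_n.+2).
Hypotheses (ltqk : (q < A.+1)%N) (kkE : kk = A.+1 :> nat).
Let x' (i : nat) := if (i == A)%N then a else x (bump q i).
Let y' (i : nat) := if (i == A)%N then b else y (bump q i).
Local Notation tau sigma := (lift_perm q kk sigma).

Lemma local_weight_peak (sigma : 'S_n.+1) (i : 'I_n.+1) :
  opens A A.+1 sigma -> i = A :> nat -> (sigma i <= A)%N ->
  local_weight A.+1 x y (tau sigma) (lift q i)
    = r * (h ^+ sigma i * l ^+ (A - sigma i)).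
Proof.
move=> op iE le.
(* Lifting over [q] moves position [A] to [kk], which closes both an excedance and an
   anti-excedance: hence [r], [h] and [l]. *)
have kE : lift q i = kk by apply: val_inj; rewrite /= /bump kkE iE; lia.
have vE : tau sigma kk = sigma i :> nat.
  rewrite -[in LHS](congr1 (tau sigma) kE) lift_perm_lift /= /bump kkE; lia.
rewrite /local_weight kE lift_permV lift_perm_id vE.
rewrite ifF; last lia.
rewrite ifT; last lia.
rewrite ifF; last lia.
rewrite -vE (@lower_weight_at _ A.+1) ?opens_lift_open ?vE //.
by rewrite subn1.
Qed.

Lemma open_sum_excedance :
  \sum_(sigma : 'S_n.+2 | opens A.+1 A.+1 sigma && (sigma q == kk))
     \prod_(i < n.+2) local_weight A.+1 x y sigma i
  = x q ^+ q * (\prod_(i < A) (if (q <= i)%N then y i.+1 else 1))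
    * (s * open_sum n.+1 A.+1 x' y'
       + r * bracket h l A.+1 * open_sum n A x' y').
Proof.
have ltAn : (A < n.+1)%N by have := ltn_ord kk; rewrite kkE.
pose AA := Ordinal ltAn.
pose Y := \prod_(i < n.+1) (if (q <= i < A)%N then y i.+1 else 1).
have <- : Y = \prod_(i < A) (if (q <= i)%N then y i.+1 else 1).
  rewrite (big_ord_widen n.+1 (fun i => if (q <= i)%N then y i.+1 else 1)) 1?ltnW // big_mkcond.
  by apply: eq_bigr => i _; case: (q <= i)%N; case: (i < A)%N.
have x'E (i : nat) : (i < A.+1)%N -> x' i = if (i == A.+1.-1)%N then a else x (bump q i) by [].
have y'E (i : nat) : (i < A.+1)%N -> y' i = if (i == A.+1.-1)%N then b else y (bump q i) by [].
rewrite reindex_lift_perm (eq_bigl (opens A A.+1)); last first.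
  by move=> sigma; rewrite opens_lift_open.
have wq (sigma : 'S_n.+1) : opens A A.+1 sigma ->
    local_weight A.+1 x y (tau sigma) q = x q ^+ q.
  move=> op; rewrite /local_weight lift_perm_id kkE ltqk.
  have <- : tau sigma q = A.+1 :> nat by rewrite lift_perm_id.
  by rewrite (@upper_weight_at _ A.+1) // ?opens_lift_open // lift_perm_id.
under eq_bigr => sigma op do rewrite (bigM_ordD1 q) wq //.
rewrite -mulr_sumr -mulrA; congr (_ * _).
(* [AA] is the former position [kk]. If it carries an excedance, a new arc replaces the closed one;
   otherwise it closes an anti-excedance too and is removed, leaving [A] open arcs of each kind. *)
rewrite mulrDr (bigID (fun sigma : 'S_n.+1 => A < sigma AA)%N) /=; congr (_ + _).
  rewrite (eq_bigl (opens A.+1 A.+1)) => [|sigma]; last exact: opens_split.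
  rewrite /open_sum !mulr_sumr; apply: eq_bigr => sigma opS.
  have := opS; rewrite -(@opens_split _ _ AA) // => /andP[op lt].
  rewrite (eq_bigr (fun i : 'I_n.+1 => (if i == AA :> nat then s else 1) *
     local_weight A.+1 x' y' sigma i * (if (q <= i < A)%N then y i.+1 else 1))).
    by rewrite !big_split (prod_if_eq AA) [RHS]mulrC.
  move=> i _; apply: local_weight_lift_open => // iE.
  by rewrite (_ : i = AA) //; apply: val_inj.
pose W v := Y * (r * (h ^+ v * l ^+ (A - v))).
have -> : Y * (r * bracket h l A.+1 * open_sum n A x' y')
   = (\sum_(v < A.+1) W v) * open_sum n A x' y'.
  rewrite -!mulr_sumr -bracket_rev mulrA; congr (_ * (_ * _) * _).
  by apply: eq_bigr => v _; rewrite subn1.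
rewrite -(@open_sum_close _ _ _ _ AA) //.
rewrite (eq_bigl (fun sigma : 'S_n.+1 => opens A A.+1 sigma && (sigma AA <= A)%N)); last first.
  by move=> sigma; rewrite -leqNgt.
apply: eq_bigr => sigma /andP[op le].
rewrite (bigM_ordD1 AA) local_weight_peak // /W /Y (bigM_ordD1 AA) /= ltnn andbF mul1r.
rewrite (eq_bigr (fun i : 'I_n => local_weight A x' y' sigma (lift AA i)
    * (if (q <= lift AA i < A)%N then y (lift AA i).+1 else 1))).
  rewrite big_split /=; ring.
move=> i _.
have ne : (lift AA i == A :> nat) = false by rewrite /= /bump; lia.
rewrite (local_weight_lift_open (x' := x') (y' := y')) // ?ne ?mul1r.
  by rewrite local_weight_openS // ne.
by move=> e; move: ne; rewrite e eqxx.
Qed.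

End CloseExcedance.

(** * The Motzkin recursion for sums over open permutations *)

Local Notation alpha := (alphaC a b f g s t u w).
Local Notation up := (fun k => p * bracket c d k.+1).
Local Notation down := (fun k => r * bracket h l k).
Local Notation M := (motzkin alpha down up).

(** Point [k] either opens an arc of each kind, or is a fixed point under [k] excedances, or closes
    one anti-excedance and opens another. *)
Lemma open_sum_not_excedance n k x y (kk : 'I_n.+1) : kk = k :> nat ->
  \sum_(sigma : 'S_n.+1 | opens k k.+1 sigma)
     \prod_(i < n.+1) local_weight k x y sigma i
  = p * open_sum n.+1 k.+1 (fun i => if i == k then c else x i)
          (fun i => if i == k then d else y i)
    + (u * w ^+ k + t * bracket f g k) * open_sum n k x y.
Proof.
move=> kE; rewrite (bigID (fun sigma : 'S_n.+1 => k < sigma kk)%N) /=; congr (_ + _).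
  rewrite (eq_bigl (opens k.+1 k.+1)) => [|sigma]; last exact: opens_split.
  rewrite /open_sum mulr_sumr; apply: eq_bigr => sigma opS.
  have := opS; rewrite -(@opens_split _ _ kk) // => /andP[op lt].
  rewrite -[X in X * _](prod_if_eq kk) -big_split; apply: eq_bigr => i _ /=.
  have [iE|ne] := eqVneq (i : nat) kk; last first.
    rewrite kE in ne; rewrite mul1r -local_weight_openS //.
    by rewrite /local_weight (negbTE ne).
  have {iE} -> : i = kk by apply: val_inj.
  have Vge : (k < sigma^-1%g kk)%N.
    rewrite ltnNge; apply/negP => le; move/opensP: opS => /(_ (sigma^-1%g kk)).
    by rewrite permKV kE ltnS => /(_ le); rewrite ltnn.
  rewrite /local_weight kE lt ltnn ltnSn eqxx.
  by rewrite ltnNge (ltnW Vge).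
(* [v = k] is the fixed point. For [v < k], the value [k] is taken further right and fills the
   vacancy among the open values. *)
pose W v := if v == k then u * w ^+ k else t * (f ^+ v * g ^+ (k - 1 - v)).
have <- : \sum_(v < k.+1) W v = u * w ^+ k + t * bracket f g k.
  rewrite big_ord_recr /= {2}/W eqxx addrC -bracket_rev mulr_sumr; congr (_ + _).
  by apply: eq_bigr => v _; rewrite /W ltn_eqF.
rewrite -(open_sum_close _ _ _ kE).
apply: eq_big => [sigma|sigma /andP[op le]]; first by rewrite -leqNgt.
rewrite -leqNgt in le; rewrite (bigM_ordD1 kk); congr (_ * _).
rewrite /local_weight kE ltnNge le /= /W ltn_neqAle le andbT.
have [sE|ne] /= := eqVneq (sigma kk : nat) k.
  by rewrite -(fixed_weight_at op kE) kE.
have op0 : opens k k sigma.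
  by apply/opensP => i lti; move/opensP: op => /(_ i lti); lia.
have lt : (sigma kk < k)%N by rewrite ltn_neqAle ne.
have -> : (k < sigma^-1%g kk)%N.
  move/opensP: op => /(_ (sigma^-1%g kk)); rewrite permKV kE ltnn => op.
  rewrite ltn_neqAle leqNgt; apply/andP; split; last by apply/negP => /op.
  apply/eqP; rewrite -[in LHS]kE => /val_inj e.
  by move: lt; rewrite [in sigma kk]e permKV kE ltnn.
by rewrite -(lower_weight_at _ _ op0 kE lt) kE.
Qed.

(** Induction on the number [m] of points still to be scanned, for all [x] and [y] since each step
    changes them. The cases are whether or not the value [k] is taken at an open position, that is,
    whether an excedance closes at [k]. *)
Lemma open_sum_motzkin m k n x y : n = (k + m)%N ->
  open_sum n k x y = (\prod_(j < k) bracket (x j) (y j) j.+1) * M m k.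
Proof.
elim: m k n x y => [|m IH] k n x y.
  rewrite addn0 => ->; case: k => [|k].
    rewrite big_ord0 mul1r /open_sum (big_pred1 1%g) ?big_ord0 //.
    move=> sigma; rewrite /= (_ : sigma = 1%g) ?eqxx; last by apply/permP => -[].
    by apply/opensP => -[].
  rewrite /= mulr0 /open_sum big_pred0 // => sigma; apply/opensP => op.
  by have := op ord0 isT; rewrite leqNgt ltn_ord.
case: n => [|n]; first by rewrite addnS.
rewrite addnS => -[nE].
have ltk : (k < n.+1)%N by rewrite nE ltnS leq_addr.
pose kk := Ordinal ltk.
rewrite {1}/open_sum (bigID (fun sigma : 'S_n.+1 => (sigma^-1)%g kk < k)%N) /=.
rewrite addrC (eq_bigl (opens k k.+1)); last first.
  move=> sigma; apply/andP/opensP => [[/opensP op nlt] i lti|op].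
    rewrite ltn_neqAle op // andbT; apply: contraNneq nlt => e.
    by rewrite (_ : kk = sigma i) ?permK //; apply: val_inj.
  split; first by apply/opensP => i /op/ltnW.
  by apply/negP => /op; rewrite permKV /= ltnn.
rewrite (open_sum_not_excedance _ _ (kk := kk)) // (IH k.+1) ?nE ?addSnnS ?addSn ?addnS // (IH k) //.
(* The new open position has parameters [c], [d], so the last bracket completes the weight of a
   rise. *)
rewrite big_ord_recr /= eqxx.
rewrite (eq_bigr (fun j : 'I_k => bracket (x j) (y j) j.+1)); last first.
  by move=> j _; rewrite ltn_eqF.
case: k => [|A] in nE ltk kk *.
  rewrite [X in _ + X = _]big_pred0 => [|sigma]; last by rewrite ltn0 andbF.
  rewrite /alphaC /bracket !big_ord0; ring.
rewrite (partition_big (fun sigma : 'S_n.+1 => (sigma^-1)%g kk) (fun q => q < A.+1)%N) /=; last first.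
  by move=> sigma /andP[].
have En : n = (n.-1).+1 by rewrite nE.
case: n En => // n _ in nE ltk kk *.
(* The arc reopened at [k] has parameters [a], [b], whence [s * bracket a b A.+1] for the horizontal
   step; only the first factor depends on [q], and [prod_bracket_bump] sums it. *)
rewrite (eq_bigr (fun q : 'I_n.+2 => (x q ^+ q * (\prod_(i < A) (if (q <= i)%N then y i.+1 else 1))
   * \prod_(j < A) bracket (x (bump q j)) (y (bump q j)) j.+1) *
     (s * bracket a b A.+1 * M m A.+1 + r * bracket h l A.+1 * M m A))); last first.
  move=> q ltq.
  rewrite (eq_bigl (fun sigma : 'S_n.+2 => opens A.+1 A.+1 sigma && (sigma q == kk))); last first.
    move=> sigma; rewrite -andbA; congr (_ && _).
    apply/andP/eqP => [[_ /eqP <-]|<-]; first by rewrite permKV.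
    by rewrite permK.
  rewrite open_sum_excedance // (IH A.+1) // (IH A); last by move: nE; rewrite addSn => -[].
  rewrite big_ord_recr /= eqxx.
  have -> : \prod_(j < A) bracket (if j == A :> nat then a else x (bump q j))
      (if j == A :> nat then b else y (bump q j)) j.+1
    = \prod_(j < A) bracket (x (bump q j)) (y (bump q j)) j.+1.
    by apply: eq_bigr => j _; rewrite ltn_eqF.
  ring.
rewrite -mulr_suml.
rewrite -(big_ord_widen n.+2 (fun q => x q ^+ q * (\prod_(i < A) (if (q <= i)%N then y i.+1 else 1))
   * \prod_(j < A) bracket (x (bump q j)) (y (bump q j)) j.+1)) 1?ltnW //.
rewrite prod_bracket_bump /alphaC; ring.
Qed.

(** * The statistics as products of local weights *)

Section Statistics.
Variables (n : nat) (sigma : 'S_n).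

Lemma expr_card (z : R) (P Q : pred 'I_n) : P =1 Q ->
  z ^+ #|[set i | P i]| = \prod_(i < n) (if Q i then z else 1).
Proof.
move=> PQ; rewrite -prodr_const big_mkcond.
by apply: eq_bigr => i _; rewrite inE PQ.
Qed.

(** Inclusion makes the subtraction in the exponent a true difference, namely the size of a set
    difference. *)
Lemma expr_cardB (z : R) (P P' Q : pred 'I_n) :
  subpred P' P -> (forall i, P i && ~~ P' i = Q i) ->
  z ^+ (#|[set i | P i]| - #|[set i | P' i]|) = \prod_(i < n) (if Q i then z else 1).
Proof.
move=> sub PQ; rewrite -cardsDS; last by apply/subsetP => i; rewrite !inE => /sub.
by rewrite -(expr_card z PQ); congr (_ ^+ #|pred_of_set _|); apply/setP => i; rewrite !inE andbC.
Qed.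

Lemma expr_card2 (z : R) (P Q : rel 'I_n) : P =2 Q ->
  z ^+ #|[set ij | let: (i, j) := ij in P i j]|
    = \prod_(i < n) \prod_(j < n) (if Q i j then z else 1).
Proof.
move=> PQ; rewrite -prodr_const big_mkcond pair_bigA.
by apply: eq_bigr => -[i j] _; rewrite inE PQ.
Qed.

Lemma expr_card2B (z : R) (P P' Q : rel 'I_n) :
  (forall i j, P' i j -> P i j) -> (forall i j, P i j && ~~ P' i j = Q i j) ->
  z ^+ (#|[set ij | let: (i, j) := ij in P i j]|
        - #|[set ij | let: (i, j) := ij in P' i j]|)
    = \prod_(i < n) \prod_(j < n) (if Q i j then z else 1).
Proof.
move=> sub PQ; rewrite -cardsDS; last first.
  by apply/subsetP => -[i j]; rewrite !inE; apply: sub.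
rewrite -(expr_card2 z PQ); congr (_ ^+ #|pred_of_set _|).
by apply/setP => -[i j]; rewrite !inE andbC.
Qed.

Local Notation E i := (i < sigma i)%N.
Local Notation D i := (sigma i < i)%N.
Local Notation L i := ((sigma^-1)%g i < i)%N.
Local Notation G i := (i < (sigma^-1)%g i)%N.

(** Each parameter gets its own guarded factor, equal to 1 outside its case, so that the product
    over [i] splits by parameter. *)
Lemma local_weight0E x y (i : 'I_n) :
  local_weight 0 x y sigma i =
    (if ~~ E i && ~~ D i then u else 1)
  * \prod_(j < n) (if [&& E i && L i, j < i & sigma i < sigma j]%N then a else 1)
  * \prod_(j < n) (if [&& E i && L i, j < i, i < sigma j & sigma j < sigma i]%N then b else 1)
  * \prod_(j < n) (if [&& E i && ~~ L i, j < i & sigma i < sigma j]%N then c else 1)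
  * \prod_(j < n) (if [&& E i && ~~ L i, j < i, i < sigma j & sigma j < sigma i]%N then d else 1)
  * \prod_(j < n) (if [&& D i && G i, i < j & sigma j < sigma i]%N then f else 1)
  * \prod_(j < n) (if [&& D i && G i, i < j, sigma i < sigma j & sigma j < i]%N then g else 1)
  * \prod_(j < n) (if [&& D i && ~~ G i, i < j & sigma j < sigma i]%N then h else 1)
  * \prod_(j < n) (if [&& D i && ~~ G i, i < j, sigma i < sigma j & sigma j < i]%N then l else 1)
  * (if E i && ~~ L i then p else 1) * (if D i && ~~ G i then r else 1)
  * (if E i && L i then s else 1) * (if D i && G i then t else 1)
  * \prod_(j < n) (if [&& ~~ E i && ~~ D i, j < i & i < sigma j]%N then w else 1).
Proof.
rewrite /local_weight ltn0; case: ltngtP => _ /=.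
- by case: (L i); rewrite /= !big1_eq big_split /=; ring.
- by case: (G i); rewrite /= !big1_eq big_split /=; ring.
- by rewrite !big1_eq; ring.
Qed.

Lemma prod_local_weight x y :
  \prod_(i < n) local_weight 0 x y sigma i =
    u ^+ #|[set i | sigma i == i]|
  * a ^+ st_ile sigma * b ^+ st_nile sigma
  * c ^+ (st_ie sigma - st_ile sigma) * d ^+ (st_nie sigma - st_nile sigma)
  * f ^+ st_ilae sigma * g ^+ st_nilae sigma
  * h ^+ (st_iae sigma - st_ilae sigma) * l ^+ (st_niae sigma - st_nilae sigma)
  * p ^+ (st_exc sigma - st_le sigma) * r ^+ (st_aexc sigma - st_lae sigma)
  * s ^+ st_le sigma * t ^+ st_lae sigma * w ^+ st_iefp sigma.
Proof.
under eq_bigr => i _ do rewrite local_weight0E.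
rewrite !big_split /=.
have mulE (x1 x2 y1 y2 : R) : x1 = x2 -> y1 = y2 -> x1 * y1 = x2 * y2 by move=> -> ->.
(* Factors are matched from the right; the two products are exchanged when the second entry of a
   pair bears the charge. *)
refine (mulE _ _ _ _ _ _); last by symmetry; rewrite [RHS]exchange_big; apply: expr_card2 => i j /=; rewrite -val_eqE /=; lia.
refine (mulE _ _ _ _ _ _); last by symmetry; apply: expr_card => i /=; lia.
refine (mulE _ _ _ _ _ _); last by symmetry; apply: expr_card => i /=; lia.
refine (mulE _ _ _ _ _ _); last by symmetry; apply: expr_cardB => i /=; lia.
refine (mulE _ _ _ _ _ _); last by symmetry; apply: expr_cardB => i /=; lia.
refine (mulE _ _ _ _ _ _); last by symmetry; apply: expr_card2B => i j /=; lia.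
refine (mulE _ _ _ _ _ _); last by symmetry; apply: expr_card2B => i j /=; lia.
refine (mulE _ _ _ _ _ _); last by symmetry; apply: expr_card2 => i j /=; lia.
refine (mulE _ _ _ _ _ _); last by symmetry; apply: expr_card2 => i j /=; lia.
refine (mulE _ _ _ _ _ _); last by symmetry; rewrite [RHS]exchange_big; apply: expr_card2B => i j /=; lia.
refine (mulE _ _ _ _ _ _); last by symmetry; rewrite [RHS]exchange_big; apply: expr_card2B => i j /=; lia.
refine (mulE _ _ _ _ _ _); last by symmetry; rewrite [RHS]exchange_big; apply: expr_card2 => i j /=; lia.
refine (mulE _ _ _ _ _ _); last by symmetry; rewrite [RHS]exchange_big; apply: expr_card2 => i j /=; lia.
by symmetry; apply: expr_card => i; rewrite -val_eqE /=; lia.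
Qed.

End Statistics.
End Weights.

(** * Colours of the fixed points and conclusion *)

Lemma sum_colw (R : comNzRingType) n k (u : 'I_k -> R) (sigma : 'S_n) :
  \sum_(phi : {ffun fixpt sigma -> 'I_k}) colw u (Tagged (fun s : 'S_n => {ffun fixpt s -> 'I_k}) phi)
  = (\sum_i u i) ^+ #|[set i | sigma i == i]|.
Proof.
rewrite /colw /= -(bigA_distr_bigA (fun=> u)) prodr_const card_sig cardsE.
by [].
Qed.

Theorem proposition1 (R : comNzRingType) (k : nat) (u : 'I_k -> R)
    (a b c d f g h l p r s t w : R) :
  is_jfraction
    (alphaC a b f g s t (\sum_(i < k) u i) w)
    (betaC c d h l p r)
    (fun n =>
       \sum_(x : arrangement n k)
         let sigma := tag x in
         colw u x
         * a ^+ st_ile sigma * b ^+ st_nile sigma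
         * c ^+ (st_ie sigma - st_ile sigma) * d ^+ (st_nie sigma - st_nile sigma)
         * f ^+ st_ilae sigma * g ^+ st_nilae sigma
         * h ^+ (st_iae sigma - st_ilae sigma) * l ^+ (st_niae sigma - st_nilae sigma)
         * p ^+ (st_exc sigma - st_le sigma) * r ^+ (st_aexc sigma - st_lae sigma)
         * s ^+ st_le sigma * t ^+ st_lae sigma * w ^+ st_iefp sigma).
Proof.
apply: (@jfraction_motzkin _ _ (fun j => r * bracket h l j) (fun j => p * bracket c d j.+1)) => [j|n].
  by rewrite /betaC; ring.
(* The scan starts with no open position, so the zero functions serve as [x] and [y]. *)
have := @open_sum_motzkin _ a b c d f g h l p r s t (\sum_(i < k) u i) w n 0 n (fun=> 0) (fun=> 0) erefl.
rewrite big_ord0 mul1r => <-.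
pose W (sigma : 'S_n) := a ^+ st_ile sigma * b ^+ st_nile sigma
         * c ^+ (st_ie sigma - st_ile sigma) * d ^+ (st_nie sigma - st_nile sigma)
         * f ^+ st_ilae sigma * g ^+ st_nilae sigma
         * h ^+ (st_iae sigma - st_ilae sigma) * l ^+ (st_niae sigma - st_nilae sigma)
         * p ^+ (st_exc sigma - st_le sigma) * r ^+ (st_aexc sigma - st_lae sigma)
         * s ^+ st_le sigma * t ^+ st_lae sigma * w ^+ st_iefp sigma.
transitivity (\sum_(sigma : 'S_n) \sum_(phi : {ffun fixpt sigma -> 'I_k})
   colw u (Tagged (fun s : 'S_n => {ffun fixpt s -> 'I_k}) phi) * W sigma).
  rewrite sig_big_dep; apply: eq_bigr => -[sigma phi] _ /=.
  by rewrite /W !mulrA.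
rewrite /open_sum; apply: eq_big => [sigma|sigma _].
  by symmetry; apply/opensP.
by rewrite -mulr_suml sum_colw prod_local_weight /W !mulrA.
Qed.
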